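(* Let $p$ be a prime with $p\equiv\pm3\pmod 8$, let $\mathbb F=\mathbb F_p$, and let $\mathfrak X$ be a ternary coherent configuration on $\mathbb F$ that is invariant with respect to $\mathrm{AGL}_1(\mathbb F)$. Then $\mathfrak X=\mathrm{Orb}_3(G)$ where $G=\mathrm{Sym}(\mathbb F)$ or $G=\mathrm{AGL}_1(\mathbb F)$.
   Context: Let $\Omega$ be a finite set and $M=\{1,2,3\}$. For $x\in\Omega^3$, $\rho(x)$ is the equivalence relation on $M$ with $i\sim j$ iff $x_i=x_j$; for a map $\sigma:M\to M$, $x^\sigma=(x_{1^\sigma},x_{2^\sigma},x_{3^\sigma})$ and $X^\sigma=\{x^\sigma:x\in X\}$; $x_{i\leftarrow\alpha}$ is $x$ with its $i$th coordinate replaced by $\alpha\in\Omega$. A partition $\mathfrak X$ of $\Omega^3$ is a ternary coherent configuration on $\Omega$ if for every class $X$: (C1) $\rho(x)$ is the same for all $x\in X$; (C2) $X^\sigma\in\mathfrak X$ for all maps $\sigma:M\to M$; (C3) for any $X_1,X_2,X_3\in\mathfrak X$ the number $|\{\alpha\in\Omega:x_{i\leftarrow\alpha}\in X_i\ \forall i\}|$ does not depend on $x\in X$. $\mathfrak X$ is invariant with respect to a group $H\le\mathrm{Sym}(\Omega)$ if $X^f=X$ for every class $X$ and every $f\in H$, with $f$ acting componentwise on triples. $\mathrm{Orb}_3(G)$ denotes the partition of $\Omega^3$ into the orbits of $G$ acting componentwise. $\mathrm{AGL}_1(\mathbb F)$ is the group of maps $x\mapsto ax+b$, $a\in\mathbb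 F^\times$, $b\in\mathbb F$. *)

(* Defs.v *)
From HB Require Import structures.
From mathcomp Require Import all_boot all_order all_algebra all_fingroup.

Set Implicit Arguments.
Unset Strict Implicit.
Unset Printing Implicit Defensive.

Import GroupScope.

Section Triples.

Variable Omega : finType.

Definition triple := {ffun 'I_3 -> Omega}.

Definition rho (x : triple) : rel 'I_3 := [rel i j | x i == x j].

Definition triple_reindex (sigma : {ffun 'I_3 -> 'I_3}) (x : triple) : triple :=
  [ffun i => x (sigma i)].

Definition triple_subst (x : triple) (i : 'I_3) (alpha : Omega) : triple :=
  [ffun j => if j == i then alpha else x j].

Definition triple_perm (x : triple) (f : {perm Omega}) : triple :=
  [ffun i => f (x i)].

Fact triple_perm_is_action : is_action [set: {perm Omega}] triple_perm.
Proof.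
split=> [f x y /ffunP eq_xy | x f g _ _].
  by apply/ffunP=> i; have := eq_xy i; rewrite !ffunE => /perm_inj.
by apply/ffunP=> i; rewrite !ffunE permM.
Qed.

Canonical triple_action := Action triple_perm_is_action.

Definition Orb3 (G : {set {perm Omega}}) : {set {set triple}} :=
  [set orbit triple_action G x | x : triple].

Record ternary_coherent (XX : {set {set triple}}) : Prop := TernaryCoherent {
  ternary_partition : partition XX [set: triple];
  ternary_C1 : forall X, X \in XX ->
    {in X &, forall x y, rho x =2 rho y};
  ternary_C2 : forall X, X \in XX -> forall sigma : {ffun 'I_3 -> 'I_3},
    triple_reindex sigma @: X \in XX;
  ternary_C3 : forall X, X \in XX ->
    forall Y : 'I_3 -> {set triple}, (forall i, Y i \in XX) ->
    {in X &, forall x y,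
      #|[set alpha | [forall i, triple_subst x i alpha \in Y i]]|
      = #|[set alpha | [forall i, triple_subst y i alpha \in Y i]]|}
}.

Definition ternary_invariant (XX : {set {set triple}}) (H : {set {perm Omega}}) :=
  forall X, X \in XX -> forall f, f \in H ->
  [set triple_perm x f | x in X] = X.

End Triples.

Section AffineGroup.

Variable F : finFieldType.

Definition AGL1 : {set {perm F}} :=
  [set f : {perm F} |
    [exists a : F, exists b : F,
      (a != 0)%R && [forall x, f x == (a * x + b)%R]]].

Lemma AGL1P (f : {perm F}) :
  reflect (exists2 a : F, (a != 0)%R & exists b : F, forall x, f x = (a * x + b)%R)
          (f \in AGL1).
Proof.
rewrite inE; apply: (iffP existsP) => [[a /existsP[b /andP[a0 /forallP fE]]] | ].
  by exists a => //; exists b => x; apply/eqP.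
case=> a a0 [b fE]; exists a; apply/existsP; exists b; rewrite a0 /=.
by apply/forallP=> x; rewrite fE.
Qed.

Fact AGL1_group_set : group_set AGL1.
Proof.
apply/group_setP; split=> [|f g /AGL1P[a a0 [b fE]] /AGL1P[c c0 [d gE]]].
  apply/AGL1P; exists 1%R; first exact: GRing.oner_neq0.
  by exists 0%R => x; rewrite perm1 GRing.mul1r GRing.addr0.
apply/AGL1P; exists (c * a)%R; first by rewrite GRing.mulf_neq0.
exists (c * b + d)%R => x.
by rewrite permM fE gE GRing.mulrDr GRing.mulrA GRing.addrA.
Qed.

Canonical AGL1_group := Group AGL1_group_set.

End AffineGroup.

(* Main.v *)
(** By 2-transitivity of AGL_1(F), the classes of triples (a, b, c) with a <> b
    are determined by the induced equivalence E on the ratio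
    x = (c - a) / (b - a). The classes {0} and {1} are singletons, E is invariant
    under x |-> 1 - x and x |-> 1/x, and its nonzero classes form a Schur ring
    over the multiplicative group of F. One must show that E is discrete, or
    has only one class besides {0} and {1}.

    Counting modulo 2 shows that for a union X of classes, the set of squares of
    those x in X with -x not in X is again a union of classes. Hence, if H is a
    subgroup that is a union of classes and contains all such squares, then x
    and -x are equivalent as soon as x^2 is not in H. As 2 is not a square, this
    together with the symmetry x |-> 1 - x forces every x^2 into H, unless H = 1,
    in which case E has one class besides {0} and {1}. Applying this first
    inside the group of squares, then (for p = 5 mod 8) inside the group of
    fourth powers, one finds that the odd order part R of the multiplicative
    group and its coset -R are unions of classes. Then the class of -1 is -D
    for a subgroup D of R, and 1 + D is the class of 2. If D is nontrivial, then
    summing the elements of 1 + D, or their squares, yields |D| = 0 in F, which is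
    absurd; and if D = 1, the singleton classes together with 0 form a subfield,
    so that E is discrete. *)

From mathcomp Require Import all_boot all_order all_algebra all_fingroup all_field.
From mathcomp Require Import cyclic ring zify.
Require Import Defs.

Set Implicit Arguments.
Unset Strict Implicit.
Unset Printing Implicit Defensive.

Import GRing.Theory.

(** * Parity counts and factorials *)

(** The points moved by [f] fall into pairs [{a, f a}], whose removal keeps the parity. *)
Lemma odd_card_invol (T : finType) (f : T -> T) (A : {set T}) :
  involutive f -> {in A, forall x, f x \in A} ->
  odd #|A| = odd #|[set x in A | f x == x]|.
Proof.
move=> fK; have [n] := ubnP #|A|; elim: n A => // n IH A leAn fA.
have [/exists_inP[a aA fa]|/exists_inPn nofix] := boolP [exists a in A, f a != a].
  have [faA ffa] := (fA a aA, fK a).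
  have faA' : f a \in A :\ a by rewrite !inE fa.
  have cA : #|A| = #|A :\ a :\ f a|.+2.
    by rewrite (cardsD1 a A) aA (cardsD1 (f a) (A :\ a)) faA'.
  rewrite cA /= negbK IH; first last.
  - move=> x; rewrite !inE => /and3P[xfa xa xA]; rewrite fA // andbT.
    rewrite (inj_eq (inv_inj fK)) xa /=.
    by apply: contra xfa => /eqP <-; rewrite fK.
  - by move: leAn; rewrite cA; lia.
  congr (odd #|pred_of_set _|); apply/setP=> x; rewrite !inE.
  case: (x =P a) => [->|_] /=; first by rewrite (negbTE fa) !andbF.
  by case: (x =P f a) => [->|_] //=; rewrite fK eq_sym (negbTE fa) andbF.
congr (odd #|pred_of_set _|); apply/setP=> x; rewrite !inE.
by case xA: (x \in A) => //=; have := nofix x xA; rewrite negbK => ->.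
Qed.

Lemma fact_split_parity m :
  m`! = (\prod_(i < m./2) (2 * i.+1) * \prod_(i < uphalf m) (2 * i).+1)%N.
Proof.
elim: m => [|m IH]; first by rewrite !big_ord0.
rewrite factS IH uphalfE /=; have := odd_double_half m.
rewrite uphalf_half; case: (odd m) => /= def_m; rewrite ?add1n ?add0n.
  by rewrite [in RHS]big_ord_recr /=; rewrite -{1}def_m -mul2n; ring.
by rewrite [in RHS]big_ord_recr /=; rewrite -{1}def_m -mul2n; ring.
Qed.

(** * Equivalence relations on affine ratios *)

Section RatioRelation.
Local Open Scope ring_scope.

Variables (F : finFieldType) (E : rel F).

Definition saturated (S : {set F}) := forall x y, E x y -> x \in S -> y \in S.

(** The field [ratio_count] is the Schur ring condition: the number of factorisations [x = a * b]
    with [a] in [A] and [b] in [B] depends only on the class of [x]. Keeping 0 out of [A] avoids the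
    convention [0^-1 = 0]. *)
Record ratio_relation : Prop := RatioRelation {
  ratio_refl : reflexive E;
  ratio_sym : symmetric E;
  ratio_trans : transitive E;
  ratio0 : forall x, E 0 x -> x = 0;
  ratio1 : forall x, E 1 x -> x = 1;
  ratioB : forall x y, E x y -> E (1 - x) (1 - y);
  ratioV : forall x y, E x y -> E x^-1 y^-1;
  ratio_count : forall (A B : {set F}) x y,
    saturated A -> saturated B -> 0 \notin A -> E x y ->
    #|[set a in A | x / a \in B]| = #|[set a in A | y / a \in B]|
}.

Definition is_trivial :=
  forall x y, x != 0 -> x != 1 -> y != 0 -> y != 1 -> E x y.

Definition is_discrete := forall x y, E x y -> x = y.

Definition mul_subgroup (H : {set F}) :=
  [/\ 1 \in H, 0 \notin H & {in H &, forall x y, x / y \in H}].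

End RatioRelation.

(** * The prime field and the quadratic character of 2 *)

Section PrimeField.
Local Open Scope ring_scope.

Variables (F : finFieldType) (p : nat).
Hypotheses (pcharF : p \in [pchar F]) (cardF : #|F| = p) (p_odd : odd p).
Hypothesis natF : forall x : F, exists2 n, (n < p)%N & x = n%:R.

Implicit Types (x y z : F) (A B Q S X Y G H L : {set F}).

Lemma natF_eq0 n : (n%:R == 0 :> F) = (p %| n)%N.
Proof. by rewrite (dvdn_pcharf pcharF). Qed.

Lemma two_neq0 : 2%:R != 0 :> F.
Proof.
rewrite natF_eq0 gtnNdvd //; have := pcharf_prime pcharF.
by case: p p_odd => [|[|[|]]].
Qed.

Lemma eqNx x : (x == - x) = (x == 0).
Proof.
by rewrite -subr_eq0 opprK -mulr2n -mulr_natl mulf_eq0 (negbTE two_neq0).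
Qed.

Lemma N1_neq1 : -1 != 1 :> F.
Proof. by rewrite eq_sym eqNx oner_eq0. Qed.

Lemma expf_pred_card x : x != 0 -> x ^+ p.-1 = 1.
Proof.
move=> x0; apply: (mulfI x0); rewrite mulr1 -exprS prednK ?prime_gt0 //.
  by rewrite -cardF expf_card.
exact: pcharf_prime pcharF.
Qed.

Lemma natF_ind_step (P : F -> Prop) :
  (forall x, P x -> P (x + 1)) -> forall x y, P x -> P y.
Proof.
move=> PS x y Px; have [n _ def_y] := natF (y - x).
have -> : y = x + n%:R by rewrite -def_y addrC subrK.
elim: n {def_y} => [|n IHn]; first by rewrite addr0.
by rewrite -addn1 natrD addrA; apply: PS.
Qed.

(* Gauss' lemma for 2: the even residues above p/2 are the negatives of the
   odd residues below p/2, and there are uphalf ((p - 1) / 2) of them. *)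
Lemma two_exp_half : 2%:R ^+ p./2 = (-1) ^+ uphalf p./2 :> F.
Proof.
set m := p./2; have def_p : p = m.*2.+1 by rewrite -[LHS]odd_double_half p_odd.
have m0 : (m`!)%:R != 0 :> F.
  rewrite natF_eq0; elim: {-2}m (leqnn m) => [|k IHk] lek.
    by rewrite gtnNdvd // prime_gt1 // (pcharf_prime pcharF).
  rewrite factS Euclid_dvdM ?(pcharf_prime pcharF) // negb_or IHk ?(ltnW lek) //.
  by rewrite gtnNdvd // def_p -addnn; lia.
apply: (mulIf m0).
have -> : 2%:R ^+ m * (m`!)%:R = \prod_(i < m) (2 * i.+1)%:R :> F.
  rewrite fact_prod big_add1 /= big_mkord natr_prod.
  under [RHS]eq_bigr do rewrite natrM.
  by rewrite big_split /= prodr_const card_ord.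
have mE : (m = m./2 + uphalf m)%N by rewrite uphalf_half; have := odd_double_half m; lia.
rewrite -(big_mkord xpredT (fun i => (2 * i.+1)%:R)) /= {1}mE.
rewrite (@big_cat_nat _ _ _ m./2) //= ?leq_addr // big_mkord.
rewrite fact_split_parity natrM !natr_prod mulrCA; congr (_ * _).
rewrite -{1}[m./2]add0n big_addn addKn big_mkord.
(* In reverse order, the even factor of index [i] and the odd number [2 * i + 1] add up to [p]. *)
have -> : \prod_(i < uphalf m) (2 * (i + m./2).+1)%:R
   = \prod_(i < uphalf m) (2 * (uphalf m - i.+1 + m./2).+1)%:R :> F.
  by rewrite (reindex_inj rev_ord_inj).
rewrite -[uphalf m in RHS]card_ord -prodr_const card_ord -big_split /=.
apply: eq_bigr => i _; rewrite mulN1r; apply/eqP; rewrite -addr_eq0 -natrD.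
rewrite natF_eq0; apply/dvdnP; exists 1%N; rewrite mul1n {1}def_p.
by have := ltn_ord i; lia.
Qed.

(** * Multiplicative subgroups and their square roots *)

Section Subgroups.

Variable H : {set F}.
Hypothesis gH : mul_subgroup H.

Lemma mgroup1 : 1 \in H. Proof. by case: gH. Qed.

Lemma mgroup_neq0 x : x \in H -> x != 0.
Proof. by case: gH => _ H0 _ xH; apply: contraNneq H0 => <-. Qed.

Lemma mgroup_div x y : x \in H -> y \in H -> x / y \in H.
Proof. by case: gH => _ _; apply. Qed.

Lemma mgroupV x : x \in H -> x^-1 \in H.
Proof. by move=> xH; rewrite -div1r mgroup_div ?mgroup1. Qed.

Lemma mgroupM x y : x \in H -> y \in H -> x * y \in H.
Proof. by move=> xH yH; rewrite -[y]invrK mgroup_div ?mgroupV. Qed.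

Lemma mgroupX x n : x \in H -> x ^+ n \in H.
Proof.
by move=> xH; elim: n => [|n IHn]; rewrite ?expr0 ?mgroup1 // exprS mgroupM.
Qed.

Lemma mgroup_mulr x y : x \in H -> (x * y \in H) = (y \in H).
Proof.
move=> xH; apply/idP/idP => [xyH|]; last exact: mgroupM.
by rewrite -(mulKf (mgroup_neq0 xH) y) mgroupM ?mgroupV.
Qed.

Lemma mgroup_exp_card x : x \in H -> x ^+ #|H| = 1.
Proof.
move=> xH; have x0 := mgroup_neq0 xH.
have nzP : \prod_(y in H) y != 0 by apply/prodf_neq0 => y; apply: mgroup_neq0.
apply: (mulIf nzP); rewrite mul1r -prodr_const -big_split /=.
rewrite [RHS](reindex_inj (mulfI x0)) /=.
by apply: eq_bigl => y; rewrite mgroup_mulr.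
Qed.

End Subgroups.

Definition sqr_root_set G := [set x : F | (x != 0) && (x ^+ 2 \in G)].

Lemma sqr_root_subgroup G : mul_subgroup G -> mul_subgroup (sqr_root_set G).
Proof.
move=> gG; split; first by rewrite inE oner_eq0 expr1n mgroup1.
  by rewrite inE eqxx.
move=> x y; rewrite !inE => /andP[x0 xG] /andP[y0 yG].
by rewrite mulf_neq0 ?invr_eq0 // exprMn exprVn mgroup_div.
Qed.

Lemma sub_sqr_root G : mul_subgroup G -> G \subset sqr_root_set G.
Proof.
by move=> gG; apply/subsetP => x xG; rewrite inE (mgroup_neq0 gG) // mgroupX.
Qed.

Lemma N1_sqr_root G : mul_subgroup G -> -1 \in sqr_root_set G.
Proof. by move=> gG; rewrite inE oppr_eq0 oner_eq0 sqrrN expr1n mgroup1. Qed.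

(** All elements of the set are roots of [X^(2 * #|G|) - 1]. *)
Lemma card_sqr_root G : mul_subgroup G -> (#|sqr_root_set G| <= 2 * #|G|)%N.
Proof.
move=> gG; set L := sqr_root_set G; set k := (2 * #|G|)%N.
have k_gt0 : (0 < k)%N by rewrite muln_gt0 /=; apply/card_gt0P; exists 1; apply: mgroup1.
rewrite -ltnS -(size_XnsubC (1 : F) k_gt0) cardE; apply: max_poly_roots.
- by rewrite -size_poly_gt0 size_XnsubC.
- apply/allP => x; rewrite mem_enum inE => /andP[_ xG].
  by rewrite rootE !hornerE exprM mgroup_exp_card // subrr.
- exact: enum_uniq.
Qed.

(** By [card_sqr_root] the index of [G] is at most 2, so [G] and [v G] exhaust the square roots. *)
Lemma sqr_root_split G v : mul_subgroup G -> v \in sqr_root_set G -> v \notin G ->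
  forall x, x \in sqr_root_set G -> x \notin G -> x / v \in G.
Proof.
move=> gG vL vG x xL xG; have gL := sqr_root_subgroup gG.
have v0 := mgroup_neq0 gL vL.
pose vGs := [set v * g | g in G].
have disj : [disjoint G & vGs].
  rewrite disjoint_subset; apply/subsetP => g gG'; rewrite inE; apply/imsetP => -[h hG def_g].
  by case/negP: vG; rewrite -(mulfK (mgroup_neq0 gG hG) v) -def_g mgroup_div.
have sub : G :|: vGs \subset sqr_root_set G.
  rewrite subUset sub_sqr_root //; apply/subsetP => _ /imsetP[g gG' ->].
  by apply: (mgroupM gL) => //; apply: (subsetP (sub_sqr_root gG)).
have /eqP eqL : G :|: vGs == sqr_root_set G.
  rewrite eqEcard sub (leq_trans (card_sqr_root gG)) //.
  rewrite cardsU disjoint_setI0 // cards0 subn0 mul2n -addnn leq_add2l.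
  by rewrite card_imset //; apply: mulfI.
move: xL; rewrite -eqL inE (negbTE xG) => /imsetP[g gG' ->].
by rewrite mulrAC divff // mul1r.
Qed.

(** * Saturated sets, their products and squares *)

Section Scheme.

Variable E : rel F.
Hypothesis hE : ratio_relation E.

Local Notation sat := (saturated E).

Let E_sym x y : E x y = E y x. Proof. exact: ratio_sym. Qed.
Let E_refl x : E x x. Proof. exact: ratio_refl. Qed.
Let E_trans y x z : E x y -> E y z -> E x z. Proof. exact: ratio_trans. Qed.

Definition cls x := [set y | E x y].

Lemma sat_cls x : sat (cls x).
Proof. by move=> y z yz; rewrite !inE => /E_trans; apply. Qed.

Lemma mem_cls x : x \in cls x. Proof. by rewrite inE. Qed.

Lemma cls_sub A x : sat A -> x \in A -> cls x \subset A.
Proof. by move=> sA xA; apply/subsetP => y; rewrite inE => /sA; apply. Qed.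

Lemma E_neq0 x y : E x y -> (x == 0) = (y == 0).
Proof.
move=> xy; apply/eqP/eqP => z0; apply: (ratio0 hE).
  by rewrite -z0.
by rewrite E_sym -z0.
Qed.

Lemma sat_mem A x y : sat A -> E x y -> (x \in A) = (y \in A).
Proof. by move=> sA xy; apply/idP/idP; apply: sA; rewrite // E_sym. Qed.

Lemma satU A B : sat A -> sat B -> sat (A :|: B).
Proof.
by move=> sA sB x y xy; rewrite !inE => /orP[/sA-> //|/sB-> //]; rewrite orbT.
Qed.

(** [ratio_count] transfers the existence of a factorisation from [a * b] to [w]; thus products of
    saturated sets are saturated. *)
Lemma sat_mul A B a b w : sat A -> sat B -> a \in A -> a != 0 -> b \in B ->
  E (a * b) w -> exists2 c, c \in A & w / c \in B.
Proof.
move=> sA sB aA a0 bB abw.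
have sA' : sat (A :\ 0).
  by move=> x y xy; rewrite !inE (E_neq0 xy) => /andP[-> /sA]; apply.
have := ratio_count hE sA' sB _ abw; rewrite !inE eqxx => /(_ isT) eq_count.
have : (0 < #|[set c in A :\ 0%R | w / c \in B]|)%N.
  by rewrite -eq_count; apply/card_gt0P; exists a; rewrite !inE a0 aA mulrAC divff ?mul1r.
by case/card_gt0P => c; rewrite !inE => /andP[/andP[_ cA] wcB]; exists c.
Qed.

Lemma satB A : sat A -> sat [set x | 1 - x \in A].
Proof. by move=> sA x y xy; rewrite !inE; apply: sA; apply: ratioB. Qed.

Lemma satV A : sat A -> sat [set x | x^-1 \in A].
Proof. by move=> sA x y xy; rewrite !inE; apply: sA; apply: ratioV. Qed.

Definition sqr_odd X := [set x ^+ 2 | x in [set x in X | - x \notin X]].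

(* z has an odd number of square roots in X precisely when z lies in
   sqr_odd X, and this is the parity of the number of a in X with z / a in X. *)
Lemma sat_sqr_odd X : sat X -> 0 \notin X -> sat (sqr_odd X).
Proof.
move=> sX X0; have nzX x : x \in X -> x != 0 by move=> xX; apply: contraNneq X0 => <-.
pose N z := [set a in X | z / a \in X].
have oddN z : z != 0 -> (z \in sqr_odd X) = odd #|N z|.
  move=> z0; pose f a := z / a.
  have fK : involutive f by move=> a; rewrite /f invf_div mulrCA divff ?mulr1.
  rewrite (odd_card_invol fK); last first.
    by move=> a; rewrite !inE => /andP[aX zaX]; rewrite zaX [z / _]fK.
  have -> : [set x in N z | f x == x] = [set x in X | x ^+ 2 == z].
    apply/setP => a; rewrite !inE; case aX: (a \in X) => //=.
    have a0 := nzX a aX; rewrite -(inj_eq (mulIf a0)) divfK // -expr2 eq_sym.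
    by case: eqP => [<-|_]; rewrite ?andbF // expr2 mulfK ?aX.
  apply/imsetP/idP => [[x /[!inE] /andP[xX NxX] ->]|].
    suff -> : [set y in X | y ^+ 2 == x ^+ 2] = [set x] by rewrite cards1.
    apply/setP => y; rewrite !inE eqf_sqr; case: (y =P x) => [->|_]; first by rewrite xX.
    by case: (y =P - x) => [->|_]; rewrite ?andbF ?(negbTE NxX).
  have [->|[a /[!inE] /andP[aX /eqP za]]] := set_0Vmem [set x in X | x ^+ 2 == z].
    by rewrite cards0.
  have [NaX|NaX _] := boolP (- a \in X); last by exists a; rewrite ?inE ?aX.
  suff -> : [set y in X | y ^+ 2 == z] = [set a; - a].
    by rewrite cards2 eqNx (nzX _ aX).
  apply/setP => y; rewrite !inE -za eqf_sqr.
  by case: (y =P a) => [->|_]; rewrite ?aX //; case: eqP => [->|_]; rewrite ?NaX ?andbF.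
move=> z w zw zS; have z0 : z != 0.
  by case/imsetP: zS => x /[!inE] /andP[xX _] ->; rewrite expf_neq0 ?nzX.
have w0 : w != 0 by rewrite -(E_neq0 zw).
by rewrite oddN // /N -(ratio_count hE sX sX X0 zw) -/(N z) -oddN.
Qed.

(* A set that is stable under [x |-> -x] and [x |-> 1 - x] is stable under
   [x |-> x + 1], so it cannot avoid 0 unless it is empty. *)
Lemma growth H L : mul_subgroup H -> mul_subgroup L -> sat H -> H \subset L ->
  -1 \in L -> (forall x, x != 0 -> x \notin L -> E x (- x)) ->
  forall h, h \in H -> h != 1 -> 1 - h \in L.
Proof.
move=> gH gL sH sHL L1 EN h hH h1.
(* [U] is the stable set; it would contain [(1 - h)^-1] if [1 - h] were outside [L]. As
   [1 - x = - x * (1 - x^-1)] with second factor in [H], the map [x |-> 1 - x] does not lead into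
   [L]. *)
pose U x := [/\ x != 0, 1 - x^-1 \in H & x \notin L].
have UN x : U x -> U (- x).
  case=> x0 xH xL; have xN := EN x x0 xL; split; rewrite ?oppr_eq0 //.
    by apply: sH xH; apply: (ratioB hE); apply: (ratioV hE).
  by apply: contra xL => /(mgroupM gL L1); rewrite mulN1r opprK.
have UB x : U x -> U (1 - x).
  case=> x0 xH xL; have h0 := mgroup_neq0 gH xH.
  have def : 1 - x = -1 * (x * (1 - x^-1)) by field.
  have x10 : 1 - x != 0 by rewrite def mulN1r oppr_eq0 mulf_neq0.
  split=> //.
    suff -> : 1 - (1 - x)^-1 = (1 - x^-1)^-1 by apply: mgroupV.
    have x1 : x - 1 != 0 by rewrite -opprB oppr_eq0.
    by field; rewrite x10 x0 x1.
  apply: contra xL; rewrite def (mgroup_mulr gL) // mulrC.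
  by rewrite (mgroup_mulr gL) //; apply: (subsetP sHL).
have US x : U x -> U (x + 1) by move=> /UN /UB; rewrite opprK addrC.
apply/negPn/negP => hL; have h10 : 1 - h != 0 by rewrite subr_eq0 eq_sym.
have U0 : U (1 - h)^-1.
  split; first by rewrite invr_eq0.
    by rewrite invrK subKr.
  by apply: contra hL => /(mgroupV gL); rewrite invrK.
by case: (natF_ind_step US 0 U0); rewrite eqxx.
Qed.

(** Since [1 + y = 1 - (- y)], the set [L] with 0 adjoined is closed under adding 1. *)
Lemma subfield_full L : -1 \in L -> {in L &, forall x y, x * y \in L} ->
  (forall h, h \in L -> h != 1 -> 1 - h \in L) -> forall x, x != 0 -> x \in L.
Proof.
move=> L1 LM LB x; apply/implyP; rewrite implyNb; apply/orP.
pose P y := y == 0 \/ y \in L; have P0 : P 0 by left.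
suff PS y : P y -> P (y + 1) by apply: (natF_ind_step PS x P0).
have L11 : 1 \in L by rewrite -[1]mul1r -mulrNN LM.
case=> [/eqP->|yL]; first by right; rewrite add0r.
have [->|Ny1] := eqVneq y (-1); first by left; rewrite addNr.
right; rewrite addrC -[y]opprK LB //; first by rewrite -mulN1r LM.
by rewrite -[1]opprK (inj_eq oppr_inj).
Qed.

(** The group [L] of square roots of [G] exceeds [G] by the coset of [1 - g], which makes [L]
    saturated. Then [growth] applies to [L] itself, and [L] with 0 adjoined is the whole field. *)
Lemma sqr_in_subgroup G g : mul_subgroup G -> sat G ->
  (forall x, x != 0 -> x ^+ 2 \notin G -> E x (- x)) ->
  g \in G -> g != 1 -> 1 - g \notin G -> forall x, x != 0 -> x ^+ 2 \in G.
Proof.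
move=> gG sG EN gG' g1 vG; set v := 1 - g in vG; set L := sqr_root_set G.
have gL : mul_subgroup L := sqr_root_subgroup gG.
have sGL : G \subset L := sub_sqr_root gG.
have L1 : -1 \in L := N1_sqr_root gG.
have ENL x : x != 0 -> x \notin L -> E x (- x).
  by move=> x0; rewrite inE x0; apply: EN.
have BL := growth gG gL sG sGL L1 ENL.
have vL : v \in L by apply: BL.
have v0 := mgroup_neq0 gL vL.
(* Apart from 0, the saturated set [V] lies in [L] by [growth]. As [v] is in [V], any class meeting
   [v G] stays in [V G], hence in [L]. *)
pose V : {set F} := [set x | 1 - x \in G] :\: G.
have sV : sat V.
  move=> x y xy; rewrite !inE (sat_mem sG xy) => /andP[-> ].
  by apply: sG; apply: ratioB.
have VL x : x \in V -> x != 0 -> x \in L.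
  move=> xV x0; have xG : 1 - x \in G by move: xV; rewrite !inE => /andP[].
  rewrite -[x](subKr 1).
  by apply: BL => //; rewrite -[X in _ != X]subr0 (inj_eq (can_inj (subKr 1))).
have vV : v \in V by rewrite !inE vG subKr.
have sL : sat L.
  move=> x y xy xL; have [xG|xG] := boolP (x \in G).
    by apply: (subsetP sGL); apply: sG xG.
  have xvG := sqr_root_split gG vL vG xL xG.
  have [|c cV ycG] := @sat_mul V G v (x / v) y sV sG vV v0 xvG.
    by rewrite mulrCA divff ?mulr1.
  have c0 : c != 0.
    by apply: contraTneq ycG => ->; rewrite invr0 mulr0; case: gG.
  by rewrite -(divfK c0 y); apply: (mgroupM gL); [apply: (subsetP sGL) | apply: VL].
have full := subfield_full L1 (mgroupM gL) (growth gL gL sL (subxx L) L1 ENL).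
by move=> x x0; have := full x x0; rewrite inE x0.
Qed.

(** * Criteria for the discrete and the trivial relation *)

Lemma discrete_of_N1 : (forall y, E (-1) y -> y = -1) -> is_discrete E.
Proof.
move=> N1; pose T := [set x | (x != 0) && [forall y, E x y ==> (y == x)]].
have TP x : reflect (x != 0 /\ forall y, E x y -> y = x) (x \in T).
  rewrite inE; apply: (iffP andP) => -[x0 xT]; split=> //.
    by move=> y xy; apply/eqP; apply: (implyP (forallP xT y)).
  by apply/forallP => y; apply/implyP => /xT ->.
have fullT : forall x, x != 0 -> x \in T.
  apply: subfield_full.
  - by apply/TP; rewrite oppr_eq0 oner_eq0.
  - move=> x y /TP[x0 xT] /TP[y0 yT]; apply/TP; rewrite mulf_neq0 //; split=> // w xyw.
    have [c] := sat_mul (@sat_cls x) (@sat_cls y) (mem_cls x) x0 (mem_cls y) xyw.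
    rewrite !inE => /xT -> /yT <-; by rewrite mulrCA divff ?mulr1.
  - move=> h /TP[h0 hT] h1; apply/TP; split; first by rewrite subr_eq0 eq_sym.
    move=> y /(ratioB hE); rewrite subKr => /hT <-.
    by rewrite subKr.
move=> x y xy; have [x0|x0] := eqVneq x 0.
  by rewrite x0 in xy *; rewrite (ratio0 hE xy).
by have /TP[_ /(_ y xy)] := fullT x x0.
Qed.

(** From [y ~ - z] follows [1 - y ~ 1 + z], which climbs through the integers. If [-1 ~ 2],
    induction links -1 to all [n] with [2 <= n < p]. Otherwise it links -1 to 3, 5, up to [p - 2],
    and [p - 2 = -2 ~ 2] is a contradiction. *)
Lemma trivial_of_opp :
  (forall x, x != 0 -> x != 1 -> x != -1 -> E x (- x)) -> is_trivial E.
Proof.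
move=> EN; have p_pr := pcharf_prime pcharF.
suff EN1 : forall x, x != 0 -> x != 1 -> E (-1) x.
  by move=> x y x0 x1 y0 y1; apply: (@E_trans (-1)); rewrite ?EN1 // E_sym EN1.
move=> x; have eqN1 n : (n%:R == -1 :> F) = (p %| n.+1)%N.
  by rewrite -subr_eq0 opprK -[1]/1%:R -natrD addn1 natF_eq0.
have eq1 n : (0 < n)%N -> (n%:R == 1 :> F) = (p %| n.-1)%N.
  by move=> n0; rewrite -subr_eq0 -[X in _ - X]/1%:R -natrB // subn1 natF_eq0.
have smallN n : (0 < n < p)%N -> (p %| n)%N = false.
  by move=> /andP[n0 np]; rewrite gtnNdvd.
have EBS y z : E y (- z) -> E (1 - y) (1 + z) by move/(ratioB hE); rewrite opprK.
have [E12|nE12] := boolP (E (-1) 2%:R).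
  have [n np ->] := natF x; case: n np => [|[|n]]; rewrite ?eqxx // => np _ _.
  elim: n np => // n IHn np; have np' := ltnW np.
  have En : E n.+2%:R (- n.+2%:R).
    by apply: EN; [rewrite natF_eq0 | rewrite eq1 // | rewrite eqN1]; rewrite smallN //; lia.
  have := EBS _ _ (E_trans (IHn np') En); rewrite opprK !nat1r.
  exact: E_trans.
have p_neq3 : p != 3.
  apply: contraNneq nE12 => p3; suff -> : 2%:R = -1 :> F by [].
  by apply/eqP; rewrite eqN1 p3.
have p_ge5 : (4 < p)%N by move: p_odd p_pr p_neq3; case: p => [|[|[|[|[|]]]]].
have E2 : E 2%:R (-2%:R).
  by apply: EN; [rewrite natF_eq0 | rewrite eq1 // | rewrite eqN1]; rewrite smallN //; lia.
have oneB2 : 1 - 2%:R = -1 :> F by rewrite -[2%:R]/(1 + 1) opprD addrA subrr add0r.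
have Eodd j : (2 * j + 3 < p)%N -> E (-1) (2 * j + 3)%:R.
  elim: j => [|j IHj] lt_jp.
    by have := EBS _ _ E2; rewrite oneB2 nat1r.
  set k := (2 * j + 3)%N in IHj *; have -> : (2 * j.+1 + 3 = k.+2)%N by rewrite /k; lia.
  have kp : (k.+2 < p)%N by rewrite /k; lia.
  have k0 : (0 < k)%N by rewrite /k addn3.
  have Ek : E (-1) k%:R by apply: IHj; lia.
  have ENk : E k%:R (- k%:R).
    by apply: EN; [rewrite natF_eq0 | rewrite eq1 // | rewrite eqN1]; rewrite smallN //; lia.
  have E2k : E 2%:R k.+1%:R.
    by have := EBS _ _ (E_trans Ek ENk); rewrite opprK !nat1r.
  have ENk1 : E k.+1%:R (- k.+1%:R).
    by apply: EN; [rewrite natF_eq0 | rewrite eq1 // | rewrite eqN1]; rewrite smallN //; lia.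
  by have := EBS _ _ (E_trans E2k ENk1); rewrite oneB2 nat1r.
case/negP: nE12; apply: (@E_trans (- 2%:R)); last by rewrite E_sym.
have := Eodd (p - 5)./2; have -> : (2 * (p - 5)./2 + 3 = p - 2)%N.
  by have := odd_double_half (p - 5); rewrite oddB ?p_odd //; lia.
rewrite natrB; last by lia.
have /eqP -> : p%:R == 0 :> F by rewrite natF_eq0.
by rewrite sub0r; apply; lia.
Qed.

(** * Cores of subgroups *)

(** The largest saturated subset of [Q]. *)
Definition core Q := [set x | cls x \subset Q].

Lemma sat_core Q : sat (core Q).
Proof.
move=> x y xy; rewrite !inE => /subsetP xQ; apply/subsetP => z; rewrite inE => yz.
by apply: xQ; rewrite inE; apply: E_trans yz.
Qed.

Lemma core_sub Q : core Q \subset Q.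
Proof. by apply/subsetP => x; rewrite inE => /subsetP/(_ x (mem_cls x)). Qed.

Lemma sub_core Q S : sat S -> S \subset Q -> S \subset core Q.
Proof.
move=> sS SQ; apply/subsetP => x xS; rewrite inE.
exact: subset_trans (cls_sub sS xS) SQ.
Qed.

(** If [w ~ x / y], then [sat_mul] writes [w] as a quotient of two elements of the core, so [w] lies
    in [Q]. *)
Lemma core_subgroup Q : mul_subgroup Q -> mul_subgroup (core Q).
Proof.
move=> gQ; have nz x : x \in core Q -> x != 0.
  by move=> /(subsetP (core_sub Q)); apply: mgroup_neq0.
split; last 1 first.
- move=> x y xC yC; rewrite inE; apply/subsetP => w; rewrite inE => xyw.
  have yVC : y^-1 \in [set z | z^-1 \in core Q] by rewrite inE invrK.
  have [c cC] := sat_mul (@sat_core Q) (satV (@sat_core Q)) xC (nz x xC) yVC xyw.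
  rewrite inE => /(subsetP (core_sub Q)) /(mgroupV gQ); rewrite invrK => wcQ.
  rewrite -(divfK (nz c cC) w); apply: (mgroupM gQ) => //.
  exact: (subsetP (core_sub Q)).
- rewrite inE; apply/subsetP => y; rewrite inE => /(ratio1 hE) ->.
  exact: mgroup1.
- by apply/negP => /nz; rewrite eqxx.
Qed.

Lemma sqr_odd_mem X x : x \in X -> - x \notin X -> x ^+ 2 \in sqr_odd X.
Proof. by move=> xX NxX; apply/imsetP; exists x; rewrite ?inE ?xX. Qed.

Lemma cls_neq0 x : x != 0 -> 0 \notin cls x.
Proof. by move=> x0; rewrite inE; apply/negP => /E_neq0; rewrite eqxx (negbTE x0). Qed.

(** [sqr_odd (cls x)] is a saturated subset of [Q], and it contains [x ^+ 2]. The contrapositive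
    supplies the equivalences [x ~ - x]. *)
Lemma sqr_in_core Q x : x != 0 -> (forall y, E x y -> y ^+ 2 \in Q) ->
  ~~ E x (- x) -> x ^+ 2 \in core Q.
Proof.
move=> x0 xQ nE; apply: (subsetP (sub_core (sat_sqr_odd (@sat_cls x) (cls_neq0 x0)) _)).
  apply/subsetP => _ /imsetP[y yX ->]; apply: xQ.
  by move: yX; rewrite !inE => /andP[].
by apply: sqr_odd_mem; rewrite inE.
Qed.

(** The quotient of [1 - h^-1] by [1 - h] is [- h^-1], so they cannot both lie in [H]; [g] is [h] or
    [h^-1]. *)
Lemma mgroup_nontriv_notin H : mul_subgroup H -> -1 \notin H ->
  forall h, h \in H -> h != 1 ->
  exists g, [/\ g \in H, g != 1 & 1 - g \notin H].
Proof.
move=> gH N1H h hH h1; have h0 := mgroup_neq0 gH hH.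
have [hB|] := boolP (1 - h \in H); last by exists h.
exists h^-1; rewrite mgroupV // invr_eq1 h1; split=> //.
apply: contra N1H => hVB; have := mgroup_div gH hVB hB.
have hB0 : 1 - h != 0 by apply: mgroup_neq0 hB.
suff -> : (1 - h^-1) / (1 - h) = h^-1 * -1 by rewrite (mgroup_mulr gH) ?mgroupV.
by field; rewrite h0 hB0.
Qed.

(** * The group of squares *)

Section Quadratic.

Definition unity_set n := [set x : F | x ^+ n == 1].

Lemma unity_subgroup n : (0 < n)%N -> mul_subgroup (unity_set n).
Proof.
move=> n0; split; first by rewrite inE expr1n.
  by rewrite inE expr0n gtn_eqF // eq_sym oner_eq0.
by move=> x y /[!inE] /eqP xn /eqP yn; rewrite exprMn exprVn xn yn divr1.
Qed.

Hypothesis two_nonres : 2%:R ^+ p./2 = -1 :> F.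

Let Q := unity_set p./2.

Lemma half_gt0 : (0 < p./2)%N.
Proof. by move: (pcharf_prime pcharF); case: p p_odd => [|[|[|]]]. Qed.

Lemma half_double : p.-1 = (p./2 * 2)%N.
Proof. by rewrite muln2 -{1}[p]odd_double_half p_odd. Qed.

Lemma sqr_nonzero x : x != 0 -> x ^+ 2 \in Q.
Proof. by move=> x0; rewrite inE -exprM mulnC -half_double expf_pred_card. Qed.

Lemma two_notin : 2%:R \notin Q.
Proof. by rewrite inE two_nonres N1_neq1. Qed.

(** If the core [H] of the squares is 1, then [x ~ - x] for all [x] other than 0, 1, -1; otherwise
    [sqr_in_subgroup] applies to [H]. *)
Lemma trivial_or_squares : is_trivial E \/ forall x, x != 0 -> x ^+ 2 \in core Q.
Proof.
have gQ : mul_subgroup Q := unity_subgroup half_gt0.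
have gH := core_subgroup gQ; set H := core Q in gH *.
have EN x : x != 0 -> x ^+ 2 \notin H -> E x (- x).
  move=> x0; apply: contraR; apply: sqr_in_core => // y xy.
  by apply: sqr_nonzero; rewrite -(E_neq0 xy).
have [/exists_inP[h hH h1]|] := boolP [exists h in H, h != 1]; last first.
  move=> /exists_inPn Htriv; left; apply: trivial_of_opp => x x0 x1 xN1.
  apply: EN => //; apply/negP => /Htriv; rewrite negbK -[1](expr1n _ 2) eqf_sqr.
  by rewrite (negbTE x1) (negbTE xN1).
right; have [g [gH' g1 gB]] : exists g, [/\ g \in H, g != 1 & 1 - g \notin H].
  have [N1H|N1H] := boolP (-1 \in H); last exact: mgroup_nontriv_notin N1H h hH h1.
  (* Here [1 - g = 2], which is not a square. *)
  exists (-1); rewrite N1H N1_neq1 opprK; split=> //.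
  by apply: contra two_notin => /(subsetP (core_sub Q)).
exact: (sqr_in_subgroup gH (@sat_core Q) EN gH' g1 gB).
Qed.

End Quadratic.

Definition neg_set S := [set x : F | - x \in S].

Lemma mem_neg_set S x : (x \in neg_set S) = (- x \in S).
Proof. by rewrite inE. Qed.

(** * The odd order subgroup [R] and its negative *)

Section OddPart.

Variable m : nat.
Hypothesis m_odd : odd m.

Let R := unity_set m.

Lemma odd_part_subgroup : mul_subgroup R.
Proof. by apply: unity_subgroup; case: m m_odd. Qed.

Lemma expNr_odd x : (- x) ^+ m = - x ^+ m.
Proof. by rewrite exprNn -signr_odd m_odd expr1 mulN1r. Qed.

Lemma mem_neg_odd x : (x \in neg_set R) = (x ^+ m == -1).
Proof. by rewrite !inE expNr_odd eqr_oppLR. Qed.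

Lemma neg_odd_disjoint x : x \in neg_set R -> x \notin R.
Proof. by rewrite mem_neg_odd inE => /eqP->; rewrite N1_neq1. Qed.

Lemma N1_neg_odd : -1 \in neg_set R.
Proof. by rewrite inE opprK (mgroup1 odd_part_subgroup). Qed.

Lemma odd_root x : x \in R -> x = (x ^+ 2) ^+ m.+1./2.
Proof.
rewrite inE => /eqP xm; rewrite -exprM mul2n halfK /= m_odd subn0.
by rewrite exprS xm mulr1.
Qed.

Lemma sqr_neg_odd x : x \in neg_set R -> x ^+ 2 \in R.
Proof. by rewrite mem_neg_odd inE -exprM mulnC exprM => /eqP->; rewrite sqrrN expr1n. Qed.

Lemma sqr_odd_part x : x ^+ 2 \in R -> (x \in R) || (x \in neg_set R).
Proof. by rewrite mem_neg_odd !inE -exprM mulnC exprM sqrf_eq1. Qed.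

(** As -1 is not in [R], the set [S] never contains both [x] and [- x], so [sqr_odd S] consists of
    all squares. *)
Lemma sat_sqr_set S : sat S -> S \subset R \/ S \subset neg_set R ->
  sat [set x ^+ 2 | x in S].
Proof.
move=> sS SR; suff <- : sqr_odd S = [set x ^+ 2 | x in S].
  apply: sat_sqr_odd => //; apply/negP => S0; have R0 : 0 \notin R by case: odd_part_subgroup.
  by case/negP: R0; case: SR => /subsetP /(_ 0 S0); rewrite ?inE ?oppr0.
rewrite /sqr_odd; congr [set _ | _ in pred_of_set _]; apply/setP => x; rewrite inE.
case xS: (x \in S) => //=; apply/negP => NxS; case: SR => /subsetP SR.
  have /neg_odd_disjoint/negP[] : x \in neg_set R by rewrite inE SR.
  exact: SR.
have /neg_odd_disjoint/negP[] : x \in neg_set R by apply: SR.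
by have := SR _ NxS; rewrite inE opprK.
Qed.

Lemma sat_pow2_set k S : sat S -> S \subset neg_set R ->
  sat [set x ^+ (2 ^ k) | x in S].
Proof.
(* The first squaring moves the set from -R into [R], so the induction carries both
   possibilities. *)
move=> sS SR; suff [] : sat [set x ^+ (2 ^ k) | x in S] /\
  ([set x ^+ (2 ^ k) | x in S] \subset R \/ [set x ^+ (2 ^ k) | x in S] \subset neg_set R) by [].
elim: k => [|k [IHs IHR]].
  suff -> : [set x ^+ (2 ^ 0) | x in S] = S by split=> //; right.
  by rewrite -[RHS]imset_id; apply: eq_imset.
have -> : [set x ^+ (2 ^ k.+1) | x in S] = [set x ^+ 2 | x in [set x ^+ (2 ^ k) | x in S]].
  by rewrite -imset_comp; apply: eq_imset => x /=; rewrite expnSr exprM.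
split; first exact: sat_sqr_set.
left; apply/subsetP => _ /imsetP[x xS ->].
case: IHR => /subsetP /(_ x xS); last exact: sqr_neg_odd.
exact: (mgroupX odd_part_subgroup).
Qed.

(* Negation on -R is a power of the squaring map, because 2 is invertible
   modulo m. *)
Lemma sat_neg_set S : sat S -> S \subset neg_set R -> sat (neg_set S).
Proof.
move=> sS SR; have m_gt0 : (0 < m)%N by case: m m_odd.
suff -> : neg_set S = [set x ^+ (2 ^ totient m) | x in S] by apply: sat_pow2_set.
have pow x : x \in S -> x ^+ (2 ^ totient m) = - x.
  move=> /(subsetP SR); rewrite !inE => /eqP xm.
  (* The exponent is even because [totient m > 0]; so [x] may be replaced by [- x], whose order
     divides [m]. *)
  have -> : x ^+ (2 ^ totient m) = (- x) ^+ (2 ^ totient m).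
    have := totient_gt0 m; rewrite m_gt0; case: (totient m) => // k _.
    by rewrite expnS !exprM sqrrN.
  rewrite -(expr_mod _ xm) Euler_exp_totient ?coprime2n //.
  by rewrite (expr_mod _ xm) expr1.
apply/setP => x; rewrite inE; apply/idP/imsetP => [NxS|[y yS ->]].
  by exists (- x); rewrite ?pow ?opprK.
by rewrite pow ?opprK.
Qed.

(** * Power sums and the class of -1 *)

Section Kernel.

Hypotheses (sR : sat R) (sNR : sat (neg_set R)).

(** Count the [a] in [Y] with [- a / w] in [Y]: with -1 in place of [w] all qualify, so by
    [ratio_count] all qualify for [w]. *)
Lemma div_stable Y w y : sat Y -> Y \subset neg_set R -> E (-1) w -> y \in Y ->
  - y / w \in Y.
Proof.
move=> sY YR Ew yY; have sNY := satV (sat_neg_set sY YR).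
have Y0 : 0 \notin Y.
  by apply/negP => /(subsetP YR); rewrite inE oppr0; apply/negP; case: odd_part_subgroup.
have := ratio_count hE sY sNY Y0 Ew.
have -> : [set a in Y | -1 / a \in [set x | x^-1 \in neg_set Y]] = Y.
  apply/setP => a; rewrite !inE invf_div; case aY: (a \in Y) => //=.
  by rewrite invrN1 mulrN1 opprK.
move=> eqY; have /eqP defY : [set a in Y | w / a \in [set x | x^-1 \in neg_set Y]] == Y.
  by rewrite eqEcard -eqY leqnn andbT; apply/subsetP => a; rewrite inE => /andP[].
by move: yY; rewrite -{1}defY !inE invf_div -mulNr => /andP[].
Qed.

(** Division by [d] permutes [S] and divides the sum by [d ^+ n], which is not 1. *)
Lemma sum_stable S d n : d != 0 -> d ^+ n != 1 ->
  {in S, forall y, y / d \in S} -> \sum_(y in S) y ^+ n = 0.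
Proof.
move=> d0 dn1 Sd; have inj : injective (fun y : F => y / d) by apply: mulIf; rewrite invr_eq0.
have /eqP defS : [set y / d | y in S] == S.
  by rewrite eqEcard card_imset // leqnn andbT; apply/subsetP => _ /imsetP[y yS ->]; apply: Sd.
have dn0 : d ^+ n != 0 by rewrite expf_neq0.
have eqS : \sum_(y in S) y ^+ n = (\sum_(y in S) y ^+ n) / d ^+ n.
  rewrite -{1}defS big_imset /=; last by move=> y z _ _ /inj.
  by rewrite mulr_suml; apply: eq_bigr => y _; rewrite exprMn exprVn.
apply/eqP; apply: contraNT dn1 => s0; apply/eqP.
by apply: (mulfI s0); rewrite mulr1 {1}eqS divfK.
Qed.

(** Either [R] is the group of squares, or it is the group of fourth powers and the squares are
    saturated too. *)
Hypothesis sqr_two : p.-1 = (m * 2)%N \/ p.-1 = (m * 4)%N /\ sat (unity_set (m * 2)).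
Hypothesis two_nonres : 2%:R ^+ p./2 = -1 :> F.

(* If w <> -1 lies in the class W of -1, then multiplication by -1/w permutes
   every saturated subset of -R, so power sums over such sets vanish; applied
   to 1 - W, or to its set of squares, this gives #|W| = 0 in F. *)
Lemma discrete_of_odd_part : is_discrete E.
Proof.
apply: discrete_of_N1 => w0 Ew0; apply/eqP; apply/negPn/negP => w01.
pose W := cls (-1); pose d := - w0.
have W_R : W \subset neg_set R := cls_sub sNR N1_neg_odd.
have d0 : d != 0 by rewrite oppr_eq0 -(E_neq0 Ew0) oppr_eq0 oner_eq0.
have d1 : d != 1 by rewrite eqr_oppLR.
have stable S : sat S -> S \subset neg_set R -> {in S, forall y, y / d \in S}.
  by move=> sS SR y yS; rewrite invrN mulrN -mulNr div_stable.
have stW := stable W (@sat_cls _) W_R.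
have d2 : d ^+ 2 != 1.
  rewrite sqrf_eq1 (negbTE d1) /=; apply: contraTneq Ew0; rewrite /d => /oppr_inj ->.
  by rewrite E_sym; apply/negP => /(ratio1 hE)/eqP; rewrite (negbTE N1_neq1).
have sumW1 : \sum_(w in W) w = 0.
  by have := sum_stable (n := 1) d0 d1 stW; under eq_bigr do rewrite expr1.
have sumW2 := sum_stable d0 d2 stW.
(* [W] is nonempty and omits 0, so [0 < #|W| < p]. *)
have kF : #|W|%:R != 0 :> F.
  rewrite natF_eq0 gtnNdvd //; first by apply/card_gt0P; exists (-1); rewrite inE.
  rewrite -cardF -cardsT; apply: proper_card; rewrite properEneq subsetT andbT.
  have : 0 \notin W by apply: cls_neq0; rewrite oppr_eq0 oner_eq0.
  by apply: contraNneq => ->; rewrite inE.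
pose Y : {set F} := [set y | 1 - y \in W].
have sY : sat Y by apply: satB; apply: sat_cls.
have YE y : y \in Y -> E 2%:R y.
  by rewrite !inE => /(ratioB hE); rewrite opprK subKr.
have sumY (f : F -> F) : \sum_(y in Y) f y = \sum_(w in W) f (1 - w) :> F.
  rewrite (reindex_inj (can_inj (subKr 1))) /=.
  by apply: eq_bigl => w; rewrite inE subKr.
have cardY : #|Y| = #|W|.
  rewrite -(card_imset _ (can_inj (subKr 1))); congr #|pred_of_set _|.
  apply/setP => w; apply/imsetP/idP => [[y /[!inE] yW ->] //|wW].
  by exists (1 - w); rewrite ?subKr // inE subKr.
have sumY1 : \sum_(y in Y) y ^+ 1 = #|W|%:R.
  rewrite sumY; under eq_bigr do rewrite expr1.
  by rewrite sumrB sumW1 subr0 sumr_const.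
have sumY2 : \sum_(y in Y) y ^+ 2 = #|W|%:R.
  rewrite sumY; have eqw (w : F) : (1 - w) ^+ 2 = (1 - 2%:R * w) + w ^+ 2 by ring.
  under eq_bigr do rewrite eqw.
  by rewrite big_split /= sumrB -mulr_sumr sumW1 sumW2 mulr0 subr0 addr0 sumr_const.
(* [Y] lies in the class of the nonsquare 2. If [R] is the group of squares, then [Y] lies in -R and
   [sumY1] must vanish. *)
case: sqr_two => [p2|[p4 sQ]].
  have half : p./2 = m.
    by apply/eqP; rewrite -(eqn_pmul2r (isT : 0 < 2)%N) -half_double p2.
  have Y_R : Y \subset neg_set R.
    apply/subsetP => y /YE; rewrite mem_neg_odd => y2.
    have y0 : y != 0 by rewrite -(E_neq0 y2) two_neq0.
    have := expf_pred_card y0; rewrite p2 exprM => /eqP; rewrite sqrf_eq1 => /orP[ym|//].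
    have : y \in R by rewrite inE.
    by rewrite -(sat_mem sR y2) inE -half two_nonres (negbTE N1_neq1).
  by move: sumY1; rewrite (sum_stable _ _ (stable Y sY Y_R)) // => /esym/eqP; apply/negP.
have half : p./2 = (m * 2)%N.
  apply/eqP; rewrite -(eqn_pmul2r (isT : 0 < 2)%N) -half_double p4.
  by rewrite -mulnA.
have Y0 : 0 \notin Y by apply/negP => /YE/E_neq0; rewrite eqxx (negbTE two_neq0).
(* With [R] the fourth powers, the elements of [Y] lie outside [R] and -R, but their squares lie in
   -R. *)
pose S := sqr_odd Y; have sS : sat S := sat_sqr_odd sY Y0.
have S_R : S \subset neg_set R.
  apply/subsetP => _ /imsetP[y yY ->]; move: yY; rewrite inE => /andP[/YE y2 _].
  have y0 : y != 0 by rewrite -(E_neq0 y2) two_neq0.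
  have := expf_pred_card y0;
  rewrite p4 (mulnA m 2 2 : (m * 4 = m * 2 * 2)%N) exprM => /eqP.
  rewrite sqrf_eq1 => /orP[ym|ym]; last by rewrite mem_neg_odd -exprM mulnC.
  have : y \in unity_set (m * 2) by rewrite inE.
  by rewrite -(sat_mem sQ y2) inE -half two_nonres (negbTE N1_neq1).
pose X := [set x in Y | - x \notin Y].
have injX : {in X &, injective (fun x : F => x ^+ 2)}.
  move=> x y /[!inE] /andP[xY _] /andP[_ NyY] /eqP; rewrite eqf_sqr => /orP[/eqP//|/eqP xy].
  by rewrite -xy xY in NyY.
(* If [X] is empty, then [Y = - Y] and the elements of [Y] sum to 0. *)
have [X0|[x xX]] := set_0Vmem X.
  have YN : {in Y, forall y, y / -1 \in Y}.
    move=> y yY; rewrite invrN1 mulrN1; apply/negPn/negP => NyY.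
    by have : y \in X; [rewrite inE yY | rewrite X0 inE].
  have N10 : -1 != 0 :> F by rewrite oppr_eq0 oner_eq0.
  by move: sumY1; rewrite (sum_stable (n := 1) N10 N1_neq1 YN) => /esym/eqP; apply/negP.
have sS' : x ^+ 2 \in S by apply/imsetP; exists x.
(* [w |-> - x ^+ 2 / w] embeds [W] into [S]; with [#|S| <= #|X| <= #|Y| = #|W|] this gives [X = Y],
   so the sum over [S] is [sumY2]. *)
have leWS : (#|W| <= #|S|)%N.
  have injs : injective (fun w => - x ^+ 2 / w).
    move=> w w' /mulfI; rewrite oppr_eq0 expf_neq0; last first.
      by apply: contraNneq Y0 => <-; case/setIdP: xX.
    by move=> /(_ isT)/invr_inj.
  rewrite -(card_imset _ injs); apply: subset_leq_card; apply/subsetP => _ /imsetP[w wW ->].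
  by apply: div_stable => //; move: wW; rewrite inE.
have /eqP XY : X == Y.
  rewrite eqEcard cardY (leq_trans leWS) ?leq_imset_card // andbT.
  by apply/subsetP => y /setIdP[].
have sumS : \sum_(s in S) s ^+ 1 = \sum_(x in X) x ^+ 2 by rewrite (big_imset _ injX).
move: sumY2; rewrite -XY -sumS.
by rewrite (sum_stable (n := 1) d0 d1 (stable S sS S_R)) => /esym/eqP; apply/negP.
Qed.

End Kernel.

(** * Descent from squares to fourth powers *)

(** Let [H] be the core of the fourth powers [R]. If -R contains no class, the relation is trivial;
    otherwise [H] and its negative form a saturated group [G] containing -1, which forces
    [H = R]. *)
Lemma trivial_or_odd_part : 2%:R ^+ p./2 = -1 :> F -> p.-1 = (m * 4)%N ->
  (forall x, x != 0 -> x ^+ 2 \in core (unity_set p./2)) ->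
  [/\ sat (unity_set (m * 2)) & is_trivial E \/ sat R /\ sat (neg_set R)].
Proof.
move=> two_nr p4; have half : p./2 = (m * 2)%N.
  apply/eqP; rewrite -(eqn_pmul2r (isT : 0 < 2)%N) -half_double p4.
  by rewrite -mulnA.
have two2 := two_notin two_nr; move: two_nr; rewrite half in two2 * => two_nr.
set Q := unity_set (m * 2) in two2 * => sqQ; have gR := odd_part_subgroup.
have QE x : (x \in Q) = (x ^+ 2 \in R) by rewrite !inE -exprM mulnC.
have Q_R x : x \in Q -> (x \in R) || (x \in neg_set R) by rewrite QE => /sqr_odd_part.
have sqr_R x : x \in R -> x = (x ^+ m.+1./2) ^+ 2.
  by move/odd_root => {1}->; rewrite -!exprM mulnC.
have sQ : sat Q.
  suff -> : Q = core Q by apply: sat_core.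
  apply/eqP; rewrite eqEsubset core_sub andbT; apply/subsetP => x xQ.
  have x0 : x != 0.
    by apply: contraTneq xQ => ->; rewrite QE expr0n; case: gR.
  have [/sqr_R ->|] := orP (Q_R x xQ); first by apply: sqQ; rewrite expf_neq0.
  (* As [2%:R ^+ m] squares to -1, the elements of -R are squares too. *)
  rewrite inE => /sqr_R def_x; have -> : x = (2%:R ^+ m * (- x) ^+ m.+1./2) ^+ 2.
    by rewrite exprMn -def_x -exprM two_nr mulN1r opprK.
  by apply: sqQ; rewrite mulf_neq0 ?expf_neq0 ?two_neq0 ?oppr_eq0.
split=> //; pose H := core R.
have gH : mul_subgroup H := core_subgroup gR.
have sH : sat H := @sat_core R.
have H_R : H \subset R := core_sub R.
have sqrH x : x \in R -> x ^+ 2 \in H -> x \in H.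
  by move=> xR x2H; rewrite (odd_root xR); apply: (mgroupX gH).
have sqrN x : x != 0 -> x \notin Q -> x ^+ 2 \in neg_set R.
  move=> x0; have := expf_pred_card x0;
  rewrite p4 (mulnA m 2 2 : (m * 4 = m * 2 * 2)%N) exprM => /eqP.
  by rewrite sqrf_eq1 mem_neg_odd !inE -exprM [(2 * m)%N]mulnC => /orP[->|].
have ENQ x : x != 0 -> x \in Q -> x ^+ 2 \notin H -> E x (- x).
  move=> x0 xQ; apply: contraR; apply: sqr_in_core => // y xy.
  by rewrite -QE -(sat_mem sQ xy).
have ENN x : x != 0 -> x \notin Q -> x ^+ 2 \notin core (neg_set R) -> E x (- x).
  move=> x0 xQ; apply: contraR; apply: sqr_in_core => // y xy.
  by rewrite sqrN -?(E_neq0 xy) // -(sat_mem sQ xy).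
(* The squares of [S] form a saturated subset of [R], and squaring is invertible on [R]. *)
have NH S : sat S -> S \subset neg_set R -> {in S, forall y, - y \in H}.
  move=> sS SR y yS; have yR := subsetP SR y yS.
  apply: sqrH; first by rewrite inE in yR.
  rewrite sqrrN; apply: (subsetP (sub_core (sat_sqr_set sS (or_intror SR)) _)).
    by apply/subsetP => _ /imsetP[z /(subsetP SR) zR ->]; apply: sqr_neg_odd.
  exact: imset_f.
have [CN0|[mu muC]] := set_0Vmem (core (neg_set R)).
  have EN x : x != 0 -> x ^+ 2 \notin H -> E x (- x).
    move=> x0 xH; have [xQ|xQ] := boolP (x \in Q); first exact: ENQ.
    by apply: ENN => //; rewrite CN0 inE.
  (* A nontrivial [x ^+ 2] in [H] would put 4 into [H] by [sqr_in_subgroup], making 2 a square. *)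
  left; apply: trivial_of_opp => x x0 x1 xN1; apply: (EN x) => //; apply/negP => x2H.
  have [||g [gH' g1 vH]] := mgroup_nontriv_notin gH _ x2H.
  - by apply/negP => /(subsetP H_R); apply/negP; rewrite neg_odd_disjoint ?N1_neg_odd.
  - by rewrite sqrf_eq1 negb_or x1.
  have two_H := sqr_in_subgroup gH sH EN gH' g1 vH two_neq0.
  by case/negP: two2; rewrite QE; apply: (subsetP H_R).
right; have muH := NH _ (@sat_core _) (core_sub _) mu muC.
have mu0 : mu != 0 by rewrite -oppr_eq0; apply: mgroup_neq0 muH.
(* As [- mu] is in [H], the negative of [H] is the product [mu H]. *)
have sNH : sat (neg_set H).
  move=> x y; rewrite !mem_neg_set => xy xH.
  have xmu : x / mu \in H by rewrite -[x / mu]mulrNN -invrN; apply: mgroup_div.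
  have [|c cC ycH] := sat_mul (@sat_core (neg_set R)) sH muC mu0 xmu (w := y).
    by rewrite mulrCA divff ?mulr1.
  have cH := NH _ (@sat_core _) (core_sub _) c cC.
  have c0 : c != 0 by rewrite -oppr_eq0; apply: mgroup_neq0 cH.
  by rewrite -(divfK c0 y) -mulrN; apply: mgroupM.
pose G := H :|: neg_set H; have sG : sat G by apply: satU.
have GE x : (x \in G) = (x \in H) || (- x \in H) by rewrite !inE.
have gG : mul_subgroup G.
  split; first by rewrite GE mgroup1.
    by rewrite GE oppr0 orbb; case: gH.
  move=> x y; rewrite !GE => /orP[] xH /orP[] yH.
  - by apply/orP; left; apply: mgroup_div.
  - by apply/orP; right; rewrite -mulrN -invrN; apply: mgroup_div.
  - by apply/orP; right; rewrite -mulNr; apply: mgroup_div.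
  - by apply/orP; left; rewrite -[x / y]mulrNN -invrN; apply: mgroup_div.
have N1G : -1 \in G by rewrite GE opprK (mgroup1 gH) orbT.
have G2 : 1 - -1 \notin G.
  rewrite opprK; apply: contra two2; rewrite GE QE -[X in _ -> X ^+ 2 \in _]/(1 + 1).
  by move=> /orP[|] /(subsetP H_R) /(mgroupX gR 2); rewrite ?sqrrN.
have EN x : x != 0 -> x ^+ 2 \notin G -> E x (- x).
  rewrite GE negb_or => x0 /andP[xH NxH]; have [xQ|xQ] := boolP (x \in Q); first exact: ENQ.
  by apply: ENN => //; apply: contra NxH; apply: NH => //; [apply: sat_core | apply: core_sub].
have sqG := sqr_in_subgroup gG sG EN N1G N1_neq1 G2.
suff <- : H = R by [].
apply/eqP; rewrite eqEsubset H_R; apply/subsetP => x xR.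
have : x \in G by rewrite (sqr_R x xR) sqG // expf_neq0 // (mgroup_neq0 gR).
rewrite GE => /orP[//|/(subsetP H_R) NxR].
have /neg_odd_disjoint/negP[] : x \in neg_set R by rewrite inE.
exact: xR.
Qed.

End OddPart.

(** * The two cases modulo 8 *)

Lemma trivial_or_discrete : p = 3 %[mod 8] \/ p = 5 %[mod 8] ->
  is_trivial E \/ is_discrete E.
Proof.
move=> p38; have two_nr : 2%:R ^+ p./2 = -1 :> F.
  (* For [p = 8k + 3] and [p = 8k + 5] alike, [uphalf p./2] is [2k + 1]. *)
  rewrite two_exp_half -signr_odd; suff -> : odd (uphalf p./2) by [].
  case: p38 => p8; have := divn_eq p 8; rewrite p8 => ->; lia.
have [|sqQ] := trivial_or_squares two_nr; first by left.
case: p38 => p8; have pE := divn_eq p 8; rewrite p8 /= in pE.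
  have odd_h : odd p./2 by lia.
  have gR : mul_subgroup (unity_set p./2) := odd_part_subgroup odd_h.
  have sR : sat (unity_set p./2).
    suff -> : unity_set p./2 = core (unity_set p./2) by apply: sat_core.
    apply/eqP; rewrite eqEsubset core_sub andbT; apply/subsetP => x xQ.
    have x0 := mgroup_neq0 gR xQ.
    by rewrite (odd_root odd_h xQ) -exprM mulnC exprM sqQ ?expf_neq0.
  right; apply: (discrete_of_odd_part odd_h) => //; last by left; rewrite half_double.
  (* Here -R is the complement of [R] among the nonzero elements. *)
  move=> x y xy xR; have xR' := neg_odd_disjoint odd_h xR.
  have y0 : y != 0.
    by rewrite -(E_neq0 xy) -oppr_eq0; apply: (mgroup_neq0 gR); rewrite inE in xR.
  have := sqr_nonzero y0; move/(sqr_odd_part odd_h); rewrite -(sat_mem sR xy).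
  by rewrite (negbTE xR').
have odd_q : odd ((p %/ 8) * 2 + 1) by lia.
have p4 : (p.-1 = ((p %/ 8) * 2 + 1) * 4)%N by lia.
have [sQ [|[sR sNR]]] := trivial_or_odd_part odd_q two_nr p4 sqQ; first by left.
by right; apply: (discrete_of_odd_part odd_q) => //; right.
Qed.

End Scheme.
End PrimeField.

(** * Triples and orbits *)

Section Triples3.

Variable T : Type.

Definition o0 : 'I_3 := @Ordinal 3 0 isT.
Definition o1 : 'I_3 := @Ordinal 3 1 isT.
Definition o2 : 'I_3 := @Ordinal 3 2 isT.

Lemma ord3_ind (P : 'I_3 -> Prop) : P o0 -> P o1 -> P o2 -> forall i, P i.
Proof.
move=> P0 P1 P2 [[|[|[|//]]] lt_i3].
- by rewrite (_ : Ordinal _ = o0) //; apply: val_inj.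
- by rewrite (_ : Ordinal _ = o1) //; apply: val_inj.
- by rewrite (_ : Ordinal _ = o2) //; apply: val_inj.
Qed.

Definition tr (a b c : T) : {ffun 'I_3 -> T} := [ffun i : 'I_3 => nth a [:: a; b; c] i].

Lemma trE (x : {ffun 'I_3 -> T}) : x = tr (x o0) (x o1) (x o2).
Proof. by apply/ffunP; apply: ord3_ind; rewrite ffunE. Qed.

End Triples3.

Lemma triple_perm_tr (T : finType) (a b c : T) (f : {perm T}) :
  triple_perm (tr a b c) f = tr (f a) (f b) (f c).
Proof. by apply/ffunP; apply: ord3_ind; rewrite !ffunE. Qed.

Lemma eq_Orb3 (T : finType) (XX : {set {set triple T}}) (G : {group {perm T}}) :
  partition XX [set: triple T] ->
  (forall x y, (pblock XX x == pblock XX y) = (y \in orbit (triple_action T) G x)) ->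
  XX = Orb3 G.
Proof.
move=> partX sameE; have [/eqP covX trivX nX0] := and3P partX.
have inX x : pblock XX x \in XX by rewrite pblock_mem // covX inE.
have blockE x : pblock XX x = orbit (triple_action T) G x.
  by apply/setP => y; rewrite -sameE eq_pblock // covX inE.
apply/setP => X; apply/idP/imsetP => [XinX|[x _ ->]]; last by rewrite -blockE.
have [X0|[x xX]] := set_0Vmem X; first by rewrite -X0 XinX in nX0.
by exists x => //; rewrite -blockE (def_pblock trivX XinX xX).
Qed.

(** * From coherent configurations to ratio relations *)

Section Coherent.
Local Open Scope ring_scope.

Variables (F : finFieldType) (XX : {set {set triple F}}).
Hypotheses (coh : ternary_coherent XX) (inv : ternary_invariant XX (AGL1 F)).

Definition same (x y : triple F) := pblock XX x == pblock XX y.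

Let partX := ternary_partition coh.

Let trivX : trivIset XX. Proof. by case/and3P: partX. Qed.

Let in_cover (x : triple F) : x \in cover XX.
Proof. by case/and3P: partX => /eqP-> _ _; rewrite inE. Qed.

Lemma block_mem x : pblock XX x \in XX. Proof. by rewrite pblock_mem. Qed.

Lemma mem_block x : x \in pblock XX x. Proof. by rewrite mem_pblock. Qed.

Lemma same_in (x y : triple F) X : X \in XX -> x \in X -> y \in X -> same x y.
Proof. by move=> XX' xX yX; rewrite /same !(def_pblock trivX XX'). Qed.

Lemma same_mem x y : same x y -> y \in pblock XX x.
Proof. by rewrite /same eq_pblock. Qed.

Lemma same_rho x y : same x y -> rho x =2 rho y.
Proof.
move=> xy; exact: (ternary_C1 coh (block_mem x) (mem_block x) (same_mem xy)).
Qed.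

Lemma same_reindex sigma x y :
  same x y -> same (triple_reindex sigma x) (triple_reindex sigma y).
Proof.
move=> xy; apply: same_in (ternary_C2 coh (block_mem x) sigma) _ _.
  exact/imset_f/mem_block.
exact/imset_f/same_mem.
Qed.

Lemma same_AGL1 (f : {perm F}) x : f \in AGL1 F -> same x (triple_perm x f).
Proof.
move=> fA; apply: same_in (block_mem x) (mem_block x) _.
by have := imset_f (fun y => triple_perm y f) (mem_block x); rewrite (inv (block_mem x) fA).
Qed.

Lemma affine_perm (a b : F) : a != 0 ->
  exists2 f : {perm F}, f \in AGL1 F & forall x, f x = a * x + b.
Proof.
move=> a0; have inj : injective (fun x : F => a * x + b) by move=> x y /addIr /(mulfI a0).
exists (perm inj) => [|x]; last by rewrite permE.
by apply/AGL1P; exists a => //; exists b => x; rewrite permE.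
Qed.

Lemma same_affine (a b x y z : F) : a != 0 ->
  same (tr x y z) (tr (a * x + b) (a * y + b) (a * z + b)).
Proof.
by move=> /(affine_perm b)[f fA fE]; rewrite -!fE -triple_perm_tr same_AGL1.
Qed.

Definition profile x alpha : {ffun 'I_3 -> {set triple F}} :=
  [ffun i => pblock XX (triple_subst x i alpha)].

(** (C3) fixes the count for each single profile; summing over the profiles satisfying [P] extends
    it to arbitrary conditions. *)
Lemma profile_count x y (P : pred {ffun 'I_3 -> {set triple F}}) : same x y ->
  #|[set alpha | P (profile x alpha)]| = #|[set alpha | P (profile y alpha)]|.
Proof.
move=> xy; have sumE z : #|[set alpha | P (profile z alpha)]| =
    (\sum_(t | P t) #|[set alpha | profile z alpha == t]|)%N.
  rewrite -sum1_card (partition_big (profile z) P) => [|a]; last by rewrite inE.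
  apply: eq_bigr => t Pt; rewrite -sum1_card; apply: eq_bigl => a; rewrite !inE.
  by case: eqP => [->|]; rewrite ?Pt ?andbF.
rewrite !sumE; apply: eq_bigr => t _.
have [/forallP tX|] := boolP [forall i, t i \in XX]; last first.
  move=> ntX; suff no z a : (profile z a == t) = false.
    by congr #|pred_of_set _|; apply/setP => a; rewrite !inE !no.
  by apply: contraNF ntX => /eqP <-; apply/forallP => i; rewrite ffunE block_mem.
suff setE z : [set a | profile z a == t] = [set a | [forall i, triple_subst z i a \in t i]].
  rewrite !setE; apply: (ternary_C3 coh (block_mem x)) => //; first exact: mem_block.
  exact: same_mem.
apply/setP => a; rewrite !inE; apply/eqP/forallP => [<- i|zt].
  by rewrite ffunE mem_block.
by apply/ffunP => i; rewrite ffunE (def_pblock trivX (tX i)).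
Qed.

Definition ratio_rel : rel F := [rel x y | same (tr 0 1 x) (tr 0 1 y)].

Lemma ratio_rel_spec : ratio_relation ratio_rel.
Proof.
have E0 x : ratio_rel 0 x -> x = 0.
  by move=> /same_rho /(_ o0 o2); rewrite /rho /= !ffunE eqxx /= => /esym/eqP.
split=> //.
- by move=> x; apply: eqxx.
- by move=> x y; apply: eq_sym.
- by move=> y x z /eqP xy /eqP yz; rewrite /ratio_rel /= /same xy yz.
- by move=> x /same_rho /(_ o1 o2); rewrite /rho /= !ffunE eqxx /= => /esym/eqP.
- move=> x y xy; have N1 : -1 != 0 :> F by rewrite oppr_eq0 oner_eq0.
  (* Exchanging the first two coordinates and applying [t |-> 1 - t] turns the ratio [z] into
     [1 - z]. *)
  have red z : same (triple_reindex (tr o1 o0 o2) (tr 0 1 z)) (tr 0 1 (1 - z)).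
    have := same_affine 1 1 0 z N1.
    rewrite mulr1 addNr mulr0 add0r mulN1r addrC; congr (is_true (same _ _)).
    by apply/ffunP; apply: ord3_ind; rewrite !ffunE /= ?ffunE.
  have := same_reindex (tr o1 o0 o2) xy.
  by rewrite /ratio_rel /= /same (eqP (red x)) (eqP (red y)).
- move=> x y xy; have [x0|x0] := eqVneq x 0.
    by move: xy; rewrite x0 => /E0 ->; rewrite /ratio_rel /= /same.
  have y0 : y != 0.
    by apply: contraNneq x0 => y0; rewrite y0 in xy; apply/eqP/E0;
      rewrite /ratio_rel /= /same eq_sym.
  (* Exchanging the last two coordinates and scaling by [z^-1] inverts the ratio. *)
  have red z : z != 0 -> same (triple_reindex (tr o0 o2 o1) (tr 0 1 z)) (tr 0 1 z^-1).
    move=> z0; have := same_affine 0 0 z 1 (invr_neq0 z0).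
    rewrite !addr0 mulr0 mulVf // mulr1; congr (is_true (same _ _)).
    by apply/ffunP; apply: ord3_ind; rewrite !ffunE /= ?ffunE.
  have := same_reindex (tr o0 o2 o1) xy.
  by rewrite /ratio_rel /= /same (eqP (red x x0)) (eqP (red y y0)).
- move=> A B x y sA sB A0 xy.
  (* Substituting [a] in the third coordinate gives the ratio [a]; in the second it gives
     [(0, a, z)], of ratio [z / a]. *)
  pose P (t : {ffun 'I_3 -> {set triple F}}) :=
    [exists a in A, tr 0 1 a \in t o2] && [exists b in B, tr 0 1 b \in t o1].
  suff setE z : [set a in A | z / a \in B] = [set a | P (profile (tr 0 1 z) a)].
    by rewrite !setE; apply: profile_count.
  apply/setP => a; rewrite !inE /P !ffunE.
  have -> : triple_subst (tr 0 1 z) o2 a = tr 0 1 a.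
    by apply/ffunP; apply: ord3_ind; rewrite !ffunE.
  have -> : triple_subst (tr 0 1 z) o1 a = tr 0 a z.
    by apply/ffunP; apply: ord3_ind; rewrite !ffunE.
  have -> : [exists b in A, tr 0 1 b \in pblock XX (tr 0 1 a)] = (a \in A).
    apply/exists_inP/idP => [[b bA]|aA]; last by exists a; rewrite ?mem_block.
    by rewrite -eq_pblock // eq_sym => ba; apply: sA bA.
  case aA: (a \in A) => //=; have a0 : a != 0 by apply: contraNneq A0 => <-.
  have red : same (tr 0 a z) (tr 0 1 (z / a)).
    have := same_affine 0 0 a z (invr_neq0 a0).
    by rewrite !addr0 mulr0 mulVf // mulrC.
  rewrite (eqP red); apply/idP/exists_inP => [zaB|[b bB]].
    by exists (z / a); rewrite ?mem_block.
  by rewrite -eq_pblock // eq_sym => ba; apply: sB bB.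
Qed.

(** Representatives of the orbits of the affine group on triples. *)
Inductive normal_triple : triple F -> Prop :=
| NormalConst : normal_triple (tr 0 0 0)
| NormalPair : normal_triple (tr 0 0 1)
| NormalRatio l : normal_triple (tr 0 1 l).

Lemma normal_form x : exists2 f, f \in AGL1 F & normal_triple (triple_perm x f).
Proof.
rewrite (trE x); move: (x o0) (x o1) (x o2) => a b c.
have [-> {b}|ab] := eqVneq b a; last first.
  have ba : (b - a)^-1 != 0 by rewrite invr_eq0 subr_eq0.
  have [f fA fE] := affine_perm (- ((b - a)^-1 * a)) ba; exists f => //.
  rewrite triple_perm_tr !fE subrr -mulrBr mulVf ?subr_eq0 //.
  exact: NormalRatio.
have [->|ac] := eqVneq c a.
  have [f fA fE] := affine_perm (- (1 * a)) (oner_neq0 F); exists f => //.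
  by rewrite triple_perm_tr !fE subrr; apply: NormalConst.
have ca : (c - a)^-1 != 0 by rewrite invr_eq0 subr_eq0.
have [f fA fE] := affine_perm (- ((c - a)^-1 * a)) ca; exists f => //.
rewrite triple_perm_tr !fE subrr -mulrBr mulVf ?subr_eq0 //.
exact: NormalPair.
Qed.

Lemma orbit_rho (G : {set {perm F}}) (x y : triple F) :
  y \in orbit (triple_action F) G x -> rho x =2 rho y.
Proof.
by case/orbitP => f _ <- i j; rewrite /rho /= !ffunE (inj_eq perm_inj).
Qed.

Lemma normal_rho u v : normal_triple u -> normal_triple v -> rho u =2 rho v ->
  u = v \/ exists l l', u = tr 0 1 l /\ v = tr 0 1 l'.
Proof.
move=> nu nv uv; have := (uv o0 o1, uv o0 o2); move: nu nv {uv}.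
have [n1 n2] : (0 == 1 :> F) = false /\ (1 == 0 :> F) = false.
  by rewrite oner_eq0 eq_sym oner_eq0.
case=> [||l] [||l']; rewrite /rho /= !ffunE /= ?eqxx ?n1 ?n2 => -[] // _ _.
- by left.
- by left.
- by right; exists l, l'.
Qed.

(** Both partitions respect [rho] and affine maps, so normal triples suffice; among these only ratio
    triples can share a pattern without being equal. *)
Lemma eq_Orb3_of_ratio (G : {group {perm F}}) : AGL1 F \subset G ->
  (forall l l', ratio_rel l l' = (tr 0 1 l' \in orbit (triple_action F) G (tr 0 1 l))) ->
  XX = Orb3 G.
Proof.
move=> sAG ratioE; apply: eq_Orb3 => // x y; rewrite -/(same x y).
have [f fA nu] := normal_form x; have [g gA nv] := normal_form y.
have sx := eqP (same_AGL1 x fA); have sy := eqP (same_AGL1 y gA).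
have ox : orbit (triple_action F) G x = orbit (triple_action F) G (triple_perm x f).
  by rewrite (orbit_act (triple_action F)) ?(subsetP sAG).
have oy z : (y \in orbit (triple_action F) G z) =
            (triple_perm y g \in orbit (triple_action F) G z).
  by rewrite (orbit_sym _ _ y) (orbit_sym _ _ (triple_perm y g))
    (orbit_act (triple_action F)) ?(subsetP sAG).
rewrite /same sx sy ox oy; move: nu nv; set u := triple_perm x f; set v := triple_perm y g.
move=> nu nv; have eqE : rho u =2 rho v ->
    (pblock XX u == pblock XX v) = (v \in orbit (triple_action F) G u).
  case/(normal_rho nu nv) => [->|[l [l' [-> ->]]]]; first by rewrite eqxx orbit_refl.
  exact: ratioE.
by apply/idP/idP => uv; [rewrite -eqE | rewrite eqE] => //;
  [apply: same_rho | apply: orbit_rho uv].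
Qed.

Lemma eq_Orb3_AGL1 : is_discrete ratio_rel -> XX = Orb3 (AGL1 F).
Proof.
move=> disc; apply: (@eq_Orb3_of_ratio (AGL1_group F)) => // l l'.
apply/idP/idP => [/disc ->|]; first exact: orbit_refl.
by case/orbitP => f fA def_l'; rewrite /ratio_rel /= -def_l'; apply: same_AGL1.
Qed.

Lemma eq_Orb3_Sym : is_trivial ratio_rel -> XX = Orb3 [set: {perm F}].
Proof.
move=> triv; apply: (@eq_Orb3_of_ratio [group of [set: {perm F}]]) => [|l l'].
  exact: subsetT.
suff eqE : rho (tr 0 1 l) =2 rho (tr 0 1 l') ->
    ratio_rel l l' = (tr 0 1 l' \in orbit (triple_action F) [set: {perm F}] (tr 0 1 l)).
  by apply/idP/idP => ll'; [rewrite -eqE | rewrite eqE] => //;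
    [apply: same_rho | apply: orbit_rho ll'].
move=> eqr; have := (eqr o0 o2, eqr o1 o2); rewrite /rho /= !ffunE /=.
rewrite ![_ == l]eq_sym ![_ == l']eq_sym => -[l0 l1].
have [ll'|ll'] := eqVneq l l'; first by rewrite ll' orbit_refl /ratio_rel /= /same eqxx.
have n0 : l != 0.
  by apply: contraNneq ll' => l00; move: l0; rewrite l00 eqxx => /esym/eqP->.
have n1 : l != 1.
  by apply: contraNneq ll' => l11; move: l1; rewrite l11 eqxx => /esym/eqP->.
have n0' : l' != 0 by rewrite -l0.
have n1' : l' != 1 by rewrite -l1.
(* The transposition of [l] and [l'] fixes 0 and 1. *)
rewrite triv //; apply/esym/orbitP; exists (tperm l l'); first exact: in_setT.
by rewrite /= triple_perm_tr tpermL !tpermD.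
Qed.

End Coherent.

Theorem theorem5p1 (p : nat) (p_prime : prime p)
    (p_mod8 : p = 3 %[mod 8] \/ p = 5 %[mod 8])
    (XX : {set {set triple 'F_p}})
    (XX_coherent : ternary_coherent XX)
    (XX_invariant : ternary_invariant XX (AGL1 'F_p)) :
  XX = Orb3 [set: {perm 'F_p}] \/ XX = Orb3 (AGL1 'F_p).
Proof.
have p_odd : odd p.
  by case: p_mod8 => p8; have := divn_eq p 8; rewrite p8 => ->; rewrite oddD oddM andbF.
have natF (x : 'F_p) : exists2 n, n < p & x = (n%:R)%R.
  exists (val x); last by rewrite natr_Zp.
  by rewrite -[X in _ < X](Fp_cast p_prime) ltn_ord.
have [triv|disc] := trivial_or_discrete (pchar_Fp p_prime) (card_Fp p_prime)
  p_odd natF (ratio_rel_spec XX_coherent XX_invariant) p_mod8.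
- by left; apply: eq_Orb3_Sym.
- by right; apply: eq_Orb3_AGL1.
Qed.
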